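(* Let $\mathfrak{B}=\{B_1,\dots,B_m\}$ be a collection of $m$ patterns, none of which contains any other as a subpattern, and let $A=a_1\dots a_l$ be an initial pattern such that no $B_i$ is a subpattern of $a_1\dots a_{l-1}$. Let $\tau_i=\tau_{AB_i}$, $\tau=\tau_{A\mathfrak{B}}=\min\{\tau_{AB_i}:1\le i\le m\}$, and for $0<\alpha<1$ let $g_\tau^j(\alpha)=E(\alpha^\tau\mathbf{1}_{\{\tau=\tau_j\}})$ ($1\le j\le m$) and $Q_\tau(\alpha)=\frac{1-E(\alpha^\tau)}{1-\alpha}$. The solution of the system of linear equations $$\left\{\begin{array}{rcl}(1-\alpha)Q_\tau(\alpha)+\sum_{j=1}^m g_\tau^j(\alpha)&=&1,\\ -Q_\tau(\alpha)+\sum_{j=1}^m (B_j\ast B_i)(\alpha)\,g_\tau^j(\alpha)&=&(A\ast B_i)(\alpha)\quad(1\le i\le m)\end{array}\right.$$ (which these functions satisfy) has the form $$Q_\tau(\alpha)=\frac{\det\mathcal{B}(\alpha)-\sum_{k=1}^m\det\mathcal{B}_k(\alpha)}{(1-\alpha)\det\mathcal{B}(\alpha)+\sum_{j=1}^m\det\mathcal{B}^j(\alpha)}$$ and, for $1\le k\le m$, $$g_\tau^k(\alpha)=\frac{(1-\alpha)\det\mathcal{B}_k(\alpha)+\sum_{j=1}^m\det\mathcal{B}_k^j(\alpha)}{(1-\alpha)\det\mathcal{B}(\alpha)+\sum_{j=1}^m\det\mathcal{B}^j(\alpha)}.$$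
   Context: Let $\xi$ be a discrete random variable whose set of possible values $\Sigma$ is called the alphabet, with $Pr(\xi=a)>0$ for every $a\in\Sigma$. Let $(\xi_n)_{n\ge1}$ be i.i.d. random letters with the same distribution as $\xi$. A pattern (word) $B$ of length $m$ is a finite ordered sequence of letters $b_1b_2\dots b_m$, $b_i\in\Sigma$; a subpattern of a word is a contiguous block (run) of consecutive letters in it. Waiting time: for an initial pattern $A=a_1\dots a_l$ and a pattern $B$ that is not a subpattern of $a_1\dots a_{l-1}$, put $\xi_0=a_l$ and $$\tau_{AB}=\min\{k\ge0: B \text{ is a subpattern of } a_1\dots a_{l-1}\xi_0\xi_1\dots\xi_k\}.$$ The case of no initial pattern, $A=\emptyset$ ($l=0$), is also allowed: then $\tau_{AB}$ is the least $k$ such that $B$ is a subpattern of $\xi_1\dots\xi_k$, and $A\ast B\equiv 0$. $\mathbf{1}_{\{\tau=\tau_j\}}$ denotes the indicator function of the event $\{\tau=\tau_j\}$. Correlation function: for a pattern $A=a_1\dots a_l$ let $A_{(k)}=a_1\dots a_k$ and $A^{(k)}=a_{l-k+1}\dots a_l$ be the subpatterns formed by its first and last $k$ letters, and $Pr(A)=Pr(\xi=a_1)\cdots Pr(\xi=a_l)$. Let $[A^{(k)}=B_{(k)}]$ be $1$ if $A^{(k)}=B_{(k)}$ and $0$ otherwise. For patterns $A$ of length $l$ and $B$ of length $m$, $$(A\ast B)(\alpha)=\sum_{k=1}^{\min\{l,m\}}\frac{[A^{(k)}=B_{(k)}]}{Pr(B_{(k)})\,\alpha^k}.$$ Matrices: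 $\mathcal{B}(\alpha)=\big((B_j\ast B_i)(\alpha)\big)_{1\le i,j\le m}$ is the $m\times m$ matrix with entry $(B_j\ast B_i)(\alpha)$ in row $i$ and column $j$. $\mathcal{B}^j(\alpha)$ is obtained from $\mathcal{B}(\alpha)$ by replacing its $j$th column by the column vector $(1)_{1\le i\le m}$ of ones. $\mathcal{B}_k(\alpha)$ is obtained from $\mathcal{B}(\alpha)$ by replacing its $k$th column by the column vector $\big((A\ast B_i)(\alpha)\big)_{1\le i\le m}$. $\mathcal{B}_k^j(\alpha)$ is obtained from $\mathcal{B}_k(\alpha)$ by replacing its $j$th column by the column vector of ones (so $\mathcal{B}_k^k=\mathcal{B}^k$). *)

(* Defs.v *)
From mathcomp Require Import all_boot all_order all_algebra.
From mathcomp Require Import all_classical all_reals all_analysis.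

Set Implicit Arguments.
Unset Strict Implicit.
Unset Printing Implicit Defensive.

Import Order.TTheory GRing.Theory Num.Theory.

Local Open Scope classical_set_scope.
Local Open Scope ring_scope.

Section RandomLetters.
Context {d : measure_display} {Omega : measurableType d} {R : realType}.
Context {Sigma : countType} (P : probability Omega R).

(* Measurability with respect to the discrete sigma-algebra on Sigma. *)
Definition discrete_rv (X : Omega -> Sigma) : Prop :=
  forall E : set Sigma, measurable (X @^-1` E).

Definition mutually_independent (X : nat -> Omega -> Sigma) : Prop :=
  forall (J : seq nat) (E : nat -> set Sigma), uniq J ->
    P (\bigcap_(n in [set` J]) (X n @^-1` E n)) =
    (\prod_(n <- J) P (X n @^-1` E n))%E.

Definition same_law (X Y : Omega -> Sigma) : Prop :=
  forall E : set Sigma, P (X @^-1` E) = P (Y @^-1` E).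

Definition iid_as (xi : Omega -> Sigma) (X : nat -> Omega -> Sigma) : Prop :=
  [/\ forall n, discrete_rv (X n),
      forall n, same_law (X n) xi
    & mutually_independent X].

Definition letter_prob (xi : Omega -> Sigma) (a : Sigma) : R :=
  fine (P (xi @^-1` [set a])).

Definition word_prob (xi : Omega -> Sigma) (s : seq Sigma) : R :=
  \prod_(a <- s) letter_prob xi a.

(* (A * B)(alpha); the sum is empty when A = [::]. *)
Definition correlation (xi : Omega -> Sigma) (A B : seq Sigma) (alpha : R) : R :=
  \sum_(1 <= k < (minn (size A) (size B)).+1)
    (drop (size A - k) A == take k B)%:R
      / (word_prob xi (take k B) * alpha ^+ k).

(* [X n] stands for the letter xi_(n+1), so the word below is A followed by
   xi_1 ... xi_k; this equals a_1 ... a_(l-1) xi_0 xi_1 ... xi_k with xi_0 = a_l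
   when A is nonempty, and xi_1 ... xi_k when A is empty.  The infimum of a
   nonempty set of naturals is its minimum, and it is +oo on the empty set. *)
Definition waiting_time (X : nat -> Omega -> Sigma) (A B : seq Sigma)
    (w : Omega) : \bar R :=
  ereal_inf [set (k%:R)%:E | k in
    [set k : nat | infix B (A ++ mkseq (fun n => X n w) k)]].

Definition first_waiting_time (X : nat -> Omega -> Sigma) (A : seq Sigma)
    (m : nat) (B : 'I_m -> seq Sigma) (w : Omega) : \bar R :=
  \big[mine/+oo%E]_(i < m) waiting_time X A (B i) w.

(* alpha ^ t for 0 < alpha < 1, with alpha ^ +oo = 0; -oo is never a value of
   a waiting time. *)
Definition pow_time (alpha : R) (t : \bar R) : R :=
  if t is r%:E then alpha `^ r else 0.

Definition gen_fun (X : nat -> Omega -> Sigma) (A : seq Sigma)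
    (m : nat) (B : 'I_m -> seq Sigma) (j : 'I_m) (alpha : R) : R :=
  fine ('E_P[fun w : Omega => pow_time alpha (first_waiting_time X A B w) *
    \1_[set w' | first_waiting_time X A B w' = waiting_time X A (B j) w'] w]).

Definition tail_gen_fun (X : nat -> Omega -> Sigma) (A : seq Sigma)
    (m : nat) (B : 'I_m -> seq Sigma) (alpha : R) : R :=
  (1 - fine ('E_P[fun w : Omega => pow_time alpha (first_waiting_time X A B w)]))
    / (1 - alpha).

End RandomLetters.

Section CorrelationMatrices.
Context {d : measure_display} {Omega : measurableType d} {R : realType}.
Context {Sigma : countType} (P : probability Omega R) (xi : Omega -> Sigma).
Context (A : seq Sigma) (m : nat) (B : 'I_m -> seq Sigma) (alpha : R).

Definition replace_col (M : 'M[R]_m) (j : 'I_m) (v : 'cV[R]_m) : 'M[R]_m :=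
  \matrix_(i, k) if k == j then v i 0 else M i k.

Definition ones_col : 'cV[R]_m := const_mx 1.

Definition init_col : 'cV[R]_m := \col_i correlation P xi A (B i) alpha.

(* Row i, column j holds (B_j * B_i)(alpha): note the order. *)
Definition corr_mx : 'M[R]_m :=
  \matrix_(i, j) correlation P xi (B j) (B i) alpha.

(* [corr_mx_up j], [corr_mx_low k] and [corr_mx_low_up k j] carry the index as
   in B^j, B_k and B_k^j respectively. *)
Definition corr_mx_up (j : 'I_m) : 'M[R]_m := replace_col corr_mx j ones_col.

Definition corr_mx_low (k : 'I_m) : 'M[R]_m := replace_col corr_mx k init_col.

Definition corr_mx_low_up (k j : 'I_m) : 'M[R]_m :=
  replace_col (corr_mx_low k) j ones_col.

(* The linear system, in the unknowns q = Q_tau(alpha), g j = g_tau^j(alpha). *)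
Definition waiting_system (q : R) (g : 'I_m -> R) : Prop :=
  (1 - alpha) * q + \sum_j g j = 1 /\
  forall i, - q + \sum_j correlation P xi (B j) (B i) alpha * g j
            = correlation P xi A (B i) alpha.

End CorrelationMatrices.

(* Main.v *)
Require Import Defs.
From mathcomp Require Import all_boot all_order all_algebra.
From mathcomp Require Import all_classical all_reals all_analysis.
From mathcomp Require Import measurable_realfun zify ring.

(** Read the initial word followed by the random letters as one infinite text,
    with positions counted from the start of the initial word.  Fix a pattern
    [B i] and a position [p], and suppose that no pattern has been completed
    up to [p] and that [B i] is written from position [p] on.  Some pattern is
    then completed for the first time at a position [p + r] with
    [1 <= r <= size (B i)], and exactly one pattern [B j] is completed there,
    because no pattern contains another.  For the same reason [B j] starts at
    or before [p], so its last [r] letters are the first [r] letters of [B i].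
    Conversely, a first completion of such a [B j] at [p + r], followed by the
    remaining letters of [B i], produces the original event.  This is a
    partition of one event into finitely many disjoint ones
    ([has_overlap_hit]).  The letters are i.i.d., so the letters written after
    a position are independent of what happened before it ([indep_word]), and
    taking probabilities turns the partition into an identity between the
    numbers P(tau > n) and P(tau = tau_j = n) ([occ_pr_hit]).

    Multiplying by [alpha ^+ p] and summing over all [p] gives the equation
    of index [i] of the linear system.  Positions [p] inside the initial word
    contribute the correlation of the initial word with [B i] ([sum_init]),
    later positions contribute Q, and the right-hand side needs no boundary
    correction since [B j] cannot be completed before position [size (B j)]
    ([renewal_identity]).  The remaining equation is Abel summation of
    P(tau > n - 1) = P(tau > n) + P(tau = n) ([free_pr_pred]).

    The matrix of the system is the correlation matrix bordered by a row of
    ones, a column of minus ones and the corner [1 - alpha]; expanding along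
    the border shows that its determinant is the denominator D of the two
    formulas ([det_bordered_opp]), and Cramer's rule gives the numerators.  For
    D <> 0, observe that the same matrix serves all initial words, and that by
    the first part the system is solvable for each of them.  The empty initial
    word has the first basis vector as right-hand side, and the words [B i] and
    [behead (B i)] have right-hand sides that differ by a nonzero multiple of
    another basis vector, because [B i] is a prefix of no other pattern
    ([correlation_behead]).  So the matrix is surjective. *)

Set Implicit Arguments.
Unset Strict Implicit.
Unset Printing Implicit Defensive.

Import Order.TTheory GRing.Theory Num.Theory.
Import numFieldNormedType.Exports.

(** * First occurrences of patterns in a fixed sequence of letters *)

Lemma suffix_le_suffix {T : eqType} (u v s : seq T) :
  suffix u s -> suffix v s -> size u <= size v -> suffix u v.
Proof.
move=> /suffixP[x ->] /suffixP[y e] le_uv; rewrite suffixE.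
have le_xy : size y <= size x by move/(congr1 size): e; rewrite !size_cat; lia.
have -> : size v - size u = size x - size y.
  by move/(congr1 size): e; rewrite !size_cat; lia.
move/(congr1 (drop (size x))): e.
rewrite drop_size_cat // drop_cat ltnNge le_xy /= => <-.
exact: eqxx.
Qed.

Section Stream.
Context {T : eqType} (W : nat -> T).

Definition block (p k : nat) : seq T := [seq W x | x <- iota p k].

Lemma size_block p k : size (block p k) = k.
Proof. by rewrite size_map size_iota. Qed.

Lemma blockD p k1 k2 : block p (k1 + k2) = block p k1 ++ block (p + k1) k2.
Proof. by rewrite /block iotaD map_cat. Qed.

Lemma block_eq_cat p (u v : seq T) :
  (block p (size (u ++ v)) == u ++ v) =
  (block p (size u) == u) && (block (p + size u) (size v) == v).
Proof. by rewrite size_cat blockD eqseq_cat ?size_block. Qed.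

Lemma infix_block_mono u n n' :
  n <= n' -> infix u (block 0 n) -> infix u (block 0 n').
Proof.
by move=> le_nn' ?; rewrite -(subnKC le_nn') blockD; apply: infix_catr.
Qed.

Lemma blockS n : block 0 n.+1 = rcons (block 0 n) (W n).
Proof. by rewrite -addn1 blockD add0n cats1. Qed.

Lemma infix_blockS u n : infix u (block 0 n.+1) ->
  ~~ infix u (block 0 n) -> suffix u (block 0 n.+1).
Proof. by rewrite blockS infix_rconsl; case/orP=> // ->. Qed.

Context {m : nat} (B : 'I_m -> seq T).

(** For the text of a waiting problem, [pattern_free n] is the event that the
    first completion comes after position [n]. *)
Definition pattern_free (n : nat) : bool :=
  [forall i, ~~ infix (B i) (block 0 n)].

(** The first completion of a pattern takes place at position [n], and the
    completed pattern is [B j]. *)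
Definition hit (j : 'I_m) (n : nat) : bool :=
  pattern_free n.-1 && suffix (B j) (block 0 n).

Lemma pattern_free_anti n n' : n <= n' -> pattern_free n' -> pattern_free n.
Proof.
move=> le_nn' /forallP free; apply/forallP=> i.
by apply: contra (free i); apply: infix_block_mono.
Qed.

Lemma hit_nfree j n : hit j n -> ~~ pattern_free n.
Proof.
case/andP=> _ hj; apply/forallPn; exists j; rewrite negbK; exact: suffixW.
Qed.

Lemma hit_size j n : hit j n -> size (B j) <= n.
Proof. by case/andP=> _ /size_suffix; rewrite size_block. Qed.

Context (B_reduced : forall i j : 'I_m, i != j -> ~~ infix (B i) (B j)).
Context (B_neq0 : forall i, 0 < size (B i)).

Lemma infix_pattern_inj i j : infix (B i) (B j) -> i = j.
Proof. by move=> h; apply/eqP; apply: contraLR h; apply: B_reduced. Qed.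

Lemma hit_gt0 j n : hit j n -> 0 < n.
Proof. by move/hit_size; apply: leq_trans. Qed.

Lemma hit_time_inj j j' n n' : hit j n -> hit j' n' -> n = n'.
Proof.
wlog lt_nn' : j j' n n' / n < n'.
  by move=> th h h'; case: (ltngtP n n') => // lt; [|symmetry];
    apply: th lt _ _; eassumption.
move=> /hit_nfree nf /andP[f _]; case/negP: nf.
by apply: pattern_free_anti f; lia.
Qed.

(** Two patterns completed at the same position would be suffixes of one
    another. *)
Lemma suffix_pattern_inj j j' (s : seq T) :
  suffix (B j) s -> suffix (B j') s -> j = j'.
Proof.
wlog le : j j' / size (B j) <= size (B j').
  by move=> th h h'; case: (leqP (size (B j)) (size (B j'))) => lt;
    [|symmetry]; apply: th => //; apply: ltnW.
move=> h h'; apply: infix_pattern_inj.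
apply: suffixW; exact: suffix_le_suffix h h' le.
Qed.

Lemma hit_inj j j' n n' : hit j n -> hit j' n' -> j = j' /\ n = n'.
Proof.
move=> h h'; have e := hit_time_inj h h'; split=> //.
move: h h'; rewrite -e => /andP[_ h] /andP[_ h'].
exact: suffix_pattern_inj h h'.
Qed.

Lemma first_hit n : ~~ pattern_free n -> exists j t, t <= n /\ hit j t.
Proof.
move=> nfree.
have [t nft tmin] := ex_minnP (ex_intro (fun t => ~~ pattern_free t) n nfree).
have t_gt0 : 0 < t.
  case: t nft {tmin} => // /forallPn[i]; rewrite negbK => /size_infix.
  by rewrite size_block leqNgt B_neq0.
have f : pattern_free t.-1 by apply: contraT => /tmin; lia.
case/forallPn: nft => j; rewrite negbK => h; exists j, t; split; first exact: tmin.
rewrite /hit f -(prednK t_gt0); apply: infix_blockS; first by rewrite prednK.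
by move/forallP: f; apply.
Qed.

(** One piece of the partition of the event that the text is pattern-free up
    to [p] and continues with [B i]: the pair [x = (j, r)] says that [B j] is
    completed first, at [p + r], and the last conjunct is the part of [B i]
    that is still to be written then. *)
Definition overlap_hit (i : 'I_m) (p : nat) (x : 'I_m * nat) : bool :=
  [&& drop (size (B x.1) - x.2) (B x.1) == take x.2 (B i),
      hit x.1 (p + x.2)
    & block (p + x.2) (size (B i) - x.2) == drop x.2 (B i)].

Definition overlaps (i : 'I_m) : seq ('I_m * nat) :=
  [seq (j, r) | j <- index_enum 'I_m,
                r <- index_iota 1 (minn (size (B j)) (size (B i))).+1].

Lemma mem_overlaps i j r :
  ((j, r) \in overlaps i) = (0 < r <= minn (size (B j)) (size (B i))).
Proof.
apply/allpairsPdep/idP => [[k [s [_]]]|lt_r].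
  by rewrite mem_index_iota => /[swap] -[-> ->].
by exists j, r; rewrite mem_index_iota mem_index_enum.
Qed.

Lemma overlaps_uniq i : uniq (overlaps i).
Proof.
apply: allpairs_uniq_dep => [|j _|[j r] [k s] _ _ [-> ->]] //=.
- exact: index_enum_uniq.
- exact: iota_uniq.
Qed.

Lemma overlap_hit_inj i p x y : overlap_hit i p x -> overlap_hit i p y -> x = y.
Proof.
case: x y => [j r] [k s] /and3P[_ /= h _] /and3P[_ /= h' _].
by have [-> /addnI ->] := hit_inj h h'.
Qed.

Lemma suffix_block p r : suffix (block p r) (block 0 (p + r)).
Proof. by rewrite blockD add0n suffix_suffix. Qed.

Lemma hit_block j p r : r <= size (B j) -> hit j (p + r) ->
  block p r = drop (size (B j) - r) (B j).
Proof.
move=> le_r /andP[_ h].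
have : suffix (block p r) (B j).
  by apply: (suffix_le_suffix (suffix_block p r)); rewrite ?size_block.
by rewrite suffixE size_block => /eqP.
Qed.

(** The event on the left determines the pair: the pattern completed first and
    the distance of its end from [p].  Conversely, the overlap and the remaining
    letters of [B i] reassemble its occurrence at [p]. *)
Lemma has_overlap_hit i p :
  pattern_free p && (block p (size (B i)) == B i) =
  has (overlap_hit i p) (overlaps i).
Proof.
apply/andP/hasP => [[free /eqP occ]|[[j r]]].
  have [|j [t [le_t h]]] := @first_hit (p + size (B i)).
    apply/forallPn; exists i; rewrite negbK; apply: suffixW.
    by rewrite -{1}occ suffix_block.
  have lt_t : p < t.
    rewrite ltnNge; apply: contra (hit_nfree h) => le_tp.
    exact: pattern_free_anti free.
  have e : t = p + (t - p) by lia.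
  have split : block p (t - p) ++ block (p + (t - p)) (size (B i) - (t - p)) = B i.
    by rewrite -blockD -[RHS]occ; congr block; lia.
  have take_i : block p (t - p) = take (t - p) (B i).
    by rewrite -split take_size_cat ?size_block.
  (* Otherwise [B j] lies inside the occurrence of [B i], hence [j = i], and
     that occurrence is too short. *)
  have le_j : t - p <= size (B j).
    rewrite leqNgt; apply/negP => lt_j.
    have sj : suffix (B j) (block p (t - p)).
      case/andP: h => _ h; apply: (suffix_le_suffix h); last by rewrite size_block ltnW.
      by rewrite {2}e suffix_block.
    have ji : j = i.
      apply: infix_pattern_inj; rewrite -split.
      by apply: infix_catr; apply: suffixW.
    by move: lt_j; rewrite ji; lia.
  exists (j, t - p); first by rewrite mem_overlaps; lia.
  apply/and3P; split=> /=.
  - by rewrite -take_i (hit_block le_j) -?e.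
  - by rewrite -e.
  - by rewrite -{2}split drop_size_cat ?size_block.
rewrite mem_overlaps => /andP[r_gt0]; rewrite leq_min => /andP[le_rj le_ri].
case/and3P=> /= /eqP ov h /eqP tail; split.
  by case/andP: h => /pattern_free_anti -> //; lia.
have -> : size (B i) = r + (size (B i) - r) by lia.
by rewrite blockD tail (hit_block le_rj h) ov cat_take_drop.
Qed.

End Stream.

Local Open Scope classical_set_scope.
Local Open Scope ring_scope.

(** * Bordered determinants and Cramer's rule *)

Definition bordered_mx {R : realType} {m : nat} (a : R) (v : 'cV[R]_m) (N : 'M[R]_m) :
    'M[R]_m.+1 :=
  \matrix_(i, j) match unlift ord0 i, unlift ord0 j with
    | None, None => a
    | None, Some _ => 1
    | Some i', None => v i' 0
    | Some i', Some j' => N i' j'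
    end.

Lemma det_replace_col {R : realType} {m : nat} (N : 'M[R]_m) k v :
  \det (replace_col N k v) = (\adj N *m v) k 0.
Proof.
rewrite (expand_det_col _ k) mxE; apply: eq_bigr => i _.
rewrite !mxE eqxx mulrC; congr (_ * _); congr (_ * \det _).
by apply/matrixP=> x y; rewrite !mxE eq_sym (negbTE (neq_lift _ _)).
Qed.

(** Expand along the first column, then expand each of the remaining minors
    along its row of ones: the result is a combination of cofactors of [N]
    that reassembles into columns replaced by [v]. *)
Lemma det_bordered {R : realType} {m : nat} (a : R) (v : 'cV[R]_m) (N : 'M[R]_m) :
  \det (bordered_mx a v N) = a * \det N - \sum_j \det (replace_col N j v).
Proof.
case: m v N => [|m] v N.
  rewrite big_ord0 subr0 det_mx11 mxE unlift_none det_mx00 mulr1 //.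
rewrite (expand_det_col _ ord0) big_ord_recl mxE unlift_none; congr (_ + _).
  rewrite /cofactor expr0 mul1r; congr (_ * \det _).
  by apply/matrixP=> i j; rewrite !mxE !liftK.
under [in RHS]eq_bigr do rewrite det_replace_col mxE.
rewrite exchange_big /= -sumrN; apply: eq_bigr => i _.
rewrite mxE liftK unlift_none -mulr_suml mulrC -mulNr; congr (_ * _).
rewrite /cofactor (expand_det_row _ ord0) -sumrN big_distrr /=.
apply: eq_bigr => j _; rewrite !mxE /=.
have -> : lift (lift ord0 i) ord0 = ord0 by exact: val_inj.
rewrite unlift_none liftK mul1r /cofactor mulrA -exprD.
rewrite add0n addn0 /bump add1n addSn exprS mulN1r mulNr; congr (- (_ * \det _)).
apply/matrixP=> x y; rewrite !mxE.
have -> : lift (lift ord0 i) (lift ord0 x) = lift ord0 (lift i x).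
  by apply: val_inj; rewrite /= /bump; lia.
by rewrite !liftK.
Qed.

Lemma cramer {R : realType} {n : nat} (M : 'M[R]_n) (x b : 'cV[R]_n) k :
  M *m x = b -> \det M * x k 0 = \det (replace_col M k b).
Proof.
by move=> <-; rewrite det_replace_col mulmxA mul_adj_mx mul_scalar_mx mxE.
Qed.

Lemma solvable_det_neq0 {R : realType} {n : nat} (M : 'M[R]_n) :
  (forall k, exists x : 'cV[R]_n, M *m x = delta_mx k 0) -> \det M != 0.
Proof.
move=> ex; have [x xP] := choice ex.
pose Y := \matrix_(i, k) x k i 0.
have MY : M *m Y = 1%:M.
  apply/matrixP=> i k; have := congr1 (fun u : 'cV[R]_n => u i 0) (xP k).
  rewrite !mxE eqxx andbT => <-; apply: eq_bigr => l _.
  by rewrite mxE.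
have := mulmx1_unit MY; rewrite unitmxE unitfE => -[] //.
Qed.

(** Index 0 holds the unknown Q, or the right-hand side of the normalizing
    equation; the other indices belong to the patterns. *)
Definition bordered_col {R : realType} {m : nat} (q : R) (h : 'I_m -> R) : 'cV[R]_m.+1 :=
  \col_i if unlift ord0 i is Some i' then h i' else q.

Lemma bordered_mulE {R : realType} {m : nat} (a : R) (v : 'cV[R]_m) (N : 'M[R]_m) q h
    (b : R) c :
  (bordered_mx a v N *m bordered_col q h = bordered_col b c) <->
  (a * q + \sum_j h j = b /\
   forall i, v i 0 * q + \sum_j N i j * h j = c i).
Proof.
have E0 : (bordered_mx a v N *m bordered_col q h) ord0 0 = a * q + \sum_j h j.
  rewrite mxE big_ord_recl !mxE !unlift_none; congr (_ + _).
  by apply: eq_bigr => j _; rewrite !mxE unlift_none liftK mul1r.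
have ES i : (bordered_mx a v N *m bordered_col q h) (lift ord0 i) 0 =
            v i 0 * q + \sum_j N i j * h j.
  rewrite mxE big_ord_recl !mxE liftK !unlift_none; congr (_ + _).
  by apply: eq_bigr => j _; rewrite !mxE !liftK.
split=> [e|[e0 es]].
  split=> [|i]; first by rewrite -E0 e mxE unlift_none.
  by rewrite -ES e mxE liftK.
apply/matrixP=> i j; rewrite ord1 {j}.
by case: (unliftP ord0 i) => [j|] ->; rewrite ?ES ?E0 mxE ?liftK ?unlift_none.
Qed.

Lemma replace_bordered0 {R : realType} {m : nat} (a : R) (v : 'cV[R]_m) (N : 'M[R]_m)
    b c :
  replace_col (bordered_mx a v N) ord0 (bordered_col b c) = bordered_mx b (\col_i c i) N.
Proof.
apply/matrixP=> i j; rewrite !mxE.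
case: (unliftP ord0 j) => [j'|] ->; rewrite ?eqxx.
  by rewrite eq_sym (negbTE (neq_lift _ _)).
by rewrite ?unlift_none; case: unlift => // k; rewrite mxE.
Qed.

Lemma replace_borderedS {R : realType} {m : nat} (a : R) (v : 'cV[R]_m) (N : 'M[R]_m)
    c k :
  replace_col (bordered_mx a v N) (lift ord0 k) (bordered_col 1 c) =
  bordered_mx a v (replace_col N k (\col_i c i)).
Proof.
apply/matrixP=> i j; rewrite !mxE.
case: (unliftP ord0 j) => [j'|] ->.
  rewrite (inj_eq (@lift_inj _ _)); case: unlift => [i'|]; last by case: ifP.
  by rewrite !mxE.
by rewrite (negbTE (neq_lift _ _)) ?unlift_none.
Qed.

Lemma det_bordered_opp {R : realType} {m : nat} (a : R) (N : 'M[R]_m) :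
  \det (bordered_mx a (const_mx (-1)) N) =
  a * \det N + \sum_j \det (replace_col N j (ones_col m)).
Proof.
rewrite det_bordered -sumrN; congr (_ + _); apply: eq_bigr => j _.
rewrite !det_replace_col -[LHS]mulN1r.
have -> : const_mx (-1) = - ones_col m :> 'cV[R]_m by apply/matrixP=> i k; rewrite !mxE.
by rewrite mulmxN mxE mulrN mulN1r !opprK.
Qed.

(** * Independence of a past event and a future word *)

Section Events.
Context {d : measure_display} {Omega : measurableType d} {R : realType}.
Context (P : probability Omega R).

Definition pr (b : Omega -> bool) : R := fine (P [set w | b w]).

Lemma prE (b : Omega -> bool) : measurable [set w | b w] -> P [set w | b w] = (pr b)%:E.
Proof. by move=> mb; rewrite /pr fineK// fin_num_measure. Qed.

Lemma eq_pr (b b' : Omega -> bool) : b =1 b' -> pr b = pr b'.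
Proof. by move=> /funext ->. Qed.

Lemma pr_false (b : Omega -> bool) : (forall w, ~~ b w) -> pr b = 0.
Proof.
move=> nb; rewrite /pr (_ : [set w | b w] = set0) ?measure0//.
by apply/seteqP; split=> // w /=; apply/negP.
Qed.

Lemma pr_true (b : Omega -> bool) : (forall w, b w) -> pr b = 1.
Proof.
move=> tb; rewrite /pr (_ : [set w | b w] = setT) ?probability_setT//.
by apply/seteqP; split=> // w _ /=.
Qed.

Lemma pr_ge0 (b : Omega -> bool) : 0 <= pr b.
Proof. by apply: fine_ge0; apply: measure_ge0. Qed.

Lemma pr_le1 (b : Omega -> bool) : measurable [set w | b w] -> pr b <= 1.
Proof. by move=> mb; rewrite -lee_fin -prE// probability_le1. Qed.

Lemma prU (b b' : Omega -> bool) :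
  measurable [set w | b w] -> measurable [set w | b' w] ->
  (forall w, b w -> ~~ b' w) -> pr (fun w => b w || b' w) = pr b + pr b'.
Proof.
move=> mb mb' dis; rewrite /pr.
have -> : [set w | b w || b' w] = [set w | b w] `|` [set w | b' w].
  by apply/seteqP; split=> w /= /orP.
rewrite measureU ?fineD ?fin_num_measure//.
by apply/seteqP; split=> // w /= [/dis/negP].
Qed.

Lemma measurable_has (I : eqType) (s : seq I) (b : I -> Omega -> bool) :
  (forall x, x \in s -> measurable [set w | b x w]) ->
  measurable [set w | has (b^~ w) s].
Proof.
elim: s => [|x s IH] mb /=.
  by rewrite (_ : [set _ | _] = set0)//; apply/seteqP; split.
have -> : [set w | b x w || has (b^~ w) s] =
          [set w | b x w] `|` [set w | has (b^~ w) s].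
  by apply/seteqP; split=> w /= /orP.
apply: measurableU; first by apply: mb; rewrite mem_head.
by apply: IH => y ys; apply: mb; rewrite in_cons ys orbT.
Qed.

Lemma pr_has (I : eqType) (s : seq I) (b : I -> Omega -> bool) : uniq s ->
  (forall x, x \in s -> measurable [set w | b x w]) ->
  (forall w x y, b x w -> b y w -> x = y) ->
  pr (fun w => has (b^~ w) s) = \sum_(x <- s) pr (b x).
Proof.
elim: s => [|x s IH] /=.
  by move=> _ _ _; rewrite big_nil pr_false.
case/andP=> xs us mb inj; rewrite big_cons -IH //.
- rewrite prU//.
  + by apply: mb; rewrite mem_head.
  + by apply: measurable_has => y ys; apply: mb; rewrite in_cons ys orbT.
  + move=> w bx; apply/hasPn => y ys; apply: contra xs => bY.
    by rewrite (inj _ _ _ bx bY).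
- by move=> y ys; apply: mb; rewrite in_cons ys orbT.
Qed.

Lemma measurable_discrete (T : countType) (f : Omega -> T) (b : pred T) :
  discrete_rv f -> measurable [set w | b (f w)].
Proof. by move=> df; exact: (df [set t | b t]). Qed.

(** A countable type is enumerated by [pickle], which reduces the decomposition
    along the values of [f] to a series indexed by the naturals. *)
Lemma total_probability (T : countType) (f : Omega -> T) (E : set Omega) :
  discrete_rv f -> measurable E ->
  P E = (\sum_(n <oo) P (E `&` [set w | pickle (f w) == n]))%E.
Proof.
move=> df mE.
have mV n : measurable (E `&` [set w | pickle (f w) == n]).
  by apply: measurableI => //; exact: (measurable_discrete (fun t => pickle t == n) df).
rewrite -{1}(_ : \bigcup_n (E `&` [set w | pickle (f w) == n]) = E).
  rewrite measure_semi_bigcup//; last exact: bigcupT_measurable.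
  by move=> i j _ _ [w [[_ /= /eqP <-] [_ /= /eqP <-]]].
by apply/seteqP; split=> [w [n _ []]//|w Ew]; exists (pickle (f w)) => /=.
Qed.

Lemma discrete_pair (S T : countType) (f : Omega -> S) (g : Omega -> T) :
  discrete_rv f -> discrete_rv g -> discrete_rv (fun w => (f w, g w)).
Proof.
move=> df dg E.
have -> : (fun w => (f w, g w)) @^-1` E =
   \bigcup_(t : T) (f @^-1` [set s | E (s, t)] `&` g @^-1` [set t]).
  by apply/seteqP; split=> [w Ew|w [t _ [/= ? ->]]//]; exists (g w).
apply: countable_bigcupT_measurable => [|t]; first exact: countableP.
exact: measurableI.
Qed.

Lemma discrete_block (T : countType) (Y : nat -> Omega -> T) p k :
  (forall n, discrete_rv (Y n)) -> discrete_rv (fun w => block (Y^~ w) p k).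
Proof.
move=> dY; elim: k p => [|k IH] p E.
  have [h|h] := pselect (E [::]).
    by rewrite (_ : _ @^-1` _ = setT)//; apply/seteqP; split.
  by rewrite (_ : _ @^-1` _ = set0)//; apply/seteqP; split.
exact: (discrete_pair (dY p) (IH p.+1) [set x | E (x.1 :: x.2)]).
Qed.

Lemma measurable_andb (b b' : Omega -> bool) : measurable [set w | b w] ->
  measurable [set w | b' w] -> measurable [set w | b w && b' w].
Proof.
move=> mb mb'; rewrite (_ : [set _ | _] = [set w | b w] `&` [set w | b' w]).
  exact: measurableI.
by apply/seteqP; split=> w /= /andP.
Qed.

End Events.

Section Words.
Context {d : measure_display} {Omega : measurableType d} {R : realType}.
Context {Sigma : countType} (P : probability Omega R).
Context (xi : Omega -> Sigma) (X : nat -> Omega -> Sigma).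
Context (X_iid : iid_as P xi X).

Let discrete_word p k : discrete_rv (fun w => block (X^~ w) p k).
Proof. by case: X_iid => dX _ _; exact: discrete_block. Qed.

Lemma word_law (u : seq Sigma) :
  P [set w | block (X^~ w) 0 (size u) == u] = (word_prob P xi u)%:E.
Proof.
case: X_iid => dX lawX indX.
case: u => [|a0 u0].
  rewrite /word_prob big_nil -(probability_setT P); congr (P _).
  by apply/seteqP; split.
move: (a0 :: u0) => u.
have := indX (iota 0 (size u)) (fun n => [set nth a0 u n]) (iota_uniq _ _).
have -> : \bigcap_(n in [set` iota 0 (size u)]) X n @^-1` [set nth a0 u n] =
          [set w | block (X^~ w) 0 (size u) == u].
  apply/seteqP; split=> w /=.
    move=> h; apply/eqP; rewrite -[RHS](mkseq_nth a0); apply/eq_in_map => n n_lt.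
    exact: h.
  move/eqP => e n /= n_lt; rewrite -{1}e (nth_map 0%N) ?size_iota.
    by rewrite nth_iota//; move: n_lt; rewrite mem_iota.
  by move: n_lt; rewrite mem_iota.
move->; rewrite /word_prob -[in RHS](mkseq_nth a0 u) big_map.
rewrite -prodEFin; apply: eq_bigr => n _.
rewrite (lawX n) /letter_prob fineK// -(lawX n) fin_num_measure//; exact: dX.
Qed.

(** Mutual independence is only given for rectangles, while an event such as
    [hit j N] is an arbitrary set of words of length [N].  Decomposing along
    the value of the first [N] letters reduces the claim to
    [word_prob (v ++ u) = word_prob v * word_prob u]. *)
Lemma indep_word N (b : pred (seq Sigma)) u :
  pr P (fun w => b (block (X^~ w) 0 N) && (block (X^~ w) N (size u) == u)) =
  pr P (fun w => b (block (X^~ w) 0 N)) * word_prob P xi u.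
Proof.
have mb := measurable_discrete b (@discrete_word 0 N).
have mu := measurable_discrete (pred1 u) (@discrete_word N (size u)).
have mbu : measurable [set w | b (block (X^~ w) 0 N) && (block (X^~ w) N (size u) == u)].
  exact: measurable_andb mb mu.
apply: EFin_inj; rewrite EFinM -!prE//.
rewrite (total_probability _ (@discrete_word 0 N) mb).
rewrite (total_probability _ (@discrete_word 0 N) mbu).
rewrite muleC -nneseriesZl; last by move=> n _; apply: measure_ge0.
apply: eq_eseriesr => n _.
set V := [set w | pickle _ == n].
set Eb := [set w | b _]; set Ebu := [set w | _ && _].
have [b0|/set0P[w0 [bw0 /= /eqP nw0]]] := eqVneq (Eb `&` V) set0.
  rewrite b0 (_ : Ebu `&` V = set0) ?measure0 ?mule0//.
  apply/seteqP; split=> // w [/= /andP[bw _] Vw].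
  by rewrite -[False]/(set0 w) -b0.
pose v := block (X^~ w0) 0 N.
have sv : size v = N by rewrite size_block.
have VE w : V w <-> block (X^~ w) 0 N = v.
  by rewrite /V /= -nw0; split=> [/eqP/(pcan_inj pickleK)|-> //].
have -> : Eb `&` V = [set w | block (X^~ w) 0 (size v) == v].
  apply/seteqP; split=> [w [_ /VE vw]|w /eqP vw] /=; rewrite sv in vw *; first exact/eqP.
  by split; [rewrite /Eb /= vw | apply/VE].
have -> : Ebu `&` V = [set w | block (X^~ w) 0 (size (v ++ u)) == v ++ u].
  apply/seteqP; split=> [w [/= /andP[_ uw] /VE vw]|w]; rewrite /= block_eq_cat add0n sv.
    by rewrite vw eqxx.
  case/andP=> /eqP vw uw; split; last exact/VE.
  by rewrite /Ebu /= vw uw andbT.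
by rewrite !word_law /word_prob big_cat/= mulrC EFinM.
Qed.

End Words.

(** * Generating functions of waiting times *)

(** Monotone convergence for a function with countably many levels, in the form
    needed for [alpha ^ tau] and its restrictions: [e k] is the event that
    [tau = k], and [f] vanishes where [tau] is infinite.  The value is finite
    because the partial sums are bounded by the total mass of the events. *)
Lemma expectation_levels {d : measure_display} {Omega : measurableType d} {R : realType}
    (P : probability Omega R) (alpha : R) (f : Omega -> R) (e : nat -> Omega -> bool) :
  0 < alpha < 1 ->
  (forall k, measurable [set w | e k w]) ->
  (forall w k k', e k w -> e k' w -> k = k') ->
  (forall w k, e k w -> f w = alpha ^+ k) ->
  (forall w, (forall k, ~~ e k w) -> f w = 0) ->
  series (fun k => alpha ^+ k * pr P (e k)) @ \oo --> fine ('E_P[f]).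
Proof.
move=> /andP[alpha_gt0 alpha_lt1] me einj fe f0.
pose u k := alpha ^+ k * pr P (e k).
have u_ge0 k : 0 <= u k by rewrite mulr_ge0 ?exprn_ge0 ?pr_ge0 ?ltW.
have cu : cvgn (series u).
  apply: nondecreasing_is_cvgn.
    by apply/nondecreasing_seqP => n; rewrite seriesSr lerDl.
  exists 1 => _ [n _ <-].
  have le1 : series u n <= \sum_(k <- index_iota 0 n) pr P (e k).
    apply: ler_sum => k _; apply: ler_piMl; first exact: pr_ge0.
    by rewrite exprn_ile1 ?ltW.
  apply: le_trans le1 _; rewrite -pr_has ?iota_uniq//.
  by apply: pr_le1; apply: measurable_has.
suff -> : ('E_P[f] = (limn (series u))%:E)%E by [].
have fE w : (f w)%:E = (\sum_(k <oo) (alpha ^+ k * \1_[set w' | e k w'] w)%:E)%E.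
  have [[k ek]|ne] := pselect (exists k, e k w).
    rewrite (@nneseriesD1 _ _ k) //; last first.
      by move=> n _; rewrite lee_fin mulr_ge0 ?exprn_ge0// ?ltW// indicE ler0n.
    rewrite indicE mem_set// mulr1 (fe w k ek) eseries0 ?adde0// => n _ /= nk.
    rewrite indicE memNset ?mulr0// => /= en.
    by move: nk; rewrite (einj _ _ _ ek en) eqxx.
  rewrite f0 ?eseries0// => [n _ _|k]; last by apply/negP => ek; apply: ne; exists k.
  by rewrite indicE memNset ?mulr0// => /= en; apply: ne; exists n.
rewrite unlock; under eq_integral do rewrite fE.
have me' k : measurable_fun setT (fun w => (alpha ^+ k * \1_[set w' | e k w'] w)%:E).
  apply/measurable_EFinP; apply: measurable_funM => //.
rewrite integral_nneseries//; last first.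
  by move=> n w _; rewrite lee_fin mulr_ge0 ?exprn_ge0// ?ltW// indicE ler0n.
rewrite -EFin_lim//; apply: congr_lim; apply/funext => n /=.
rewrite -sumEFin; apply: eq_bigr => k _.
under eq_integral do rewrite EFinM.
rewrite ge0_integralZl_EFin//.
- by rewrite integral_indic// setIT /u EFinM; congr (_ * _)%E; exact: prE.
- exact/measurable_EFinP/measurable_indic.
- by rewrite exprn_ge0// ltW.
Qed.

Section Waiting.
Context {d : measure_display} {Omega : measurableType d} {R : realType}.
Context {Sigma : countType}.
Context (X : nat -> Omega -> Sigma) (A : seq Sigma).

(** The initial word followed by the random letters.  The default [X 0 w] is
    never returned by [nth]. *)
Definition text (w : Omega) (p : nat) : Sigma :=
  if (p < size A)%N then nth (X 0 w) A p else X (p - size A) w.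

Lemma block_text_ge w p k : block (text w) (size A + p) k = block (X^~ w) p k.
Proof.
rewrite /block iotaDl -map_comp; apply: eq_map => n /=.
by rewrite /text ltnNge leq_addr /= addKn.
Qed.

Lemma block_text_init w p : (p <= size A)%N -> block (text w) 0 p = take p A.
Proof.
move=> le_p; apply: (@eq_from_nth _ (X 0 w)).
  by rewrite size_block size_takel.
move=> n; rewrite size_block => n_lt.
rewrite (nth_map 0%N) ?size_iota// nth_iota// add0n nth_take//.
by rewrite /text (leq_trans n_lt).
Qed.

Lemma block_text w k : block (text w) 0 (size A + k) = A ++ block (X^~ w) 0 k.
Proof.
by rewrite blockD block_text_init// take_size add0n -[size A]addn0 block_text_ge.
Qed.

Lemma ereal_inf_nat_ge (p : pred nat) k : (forall n, (n < k)%N -> ~~ p n) ->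
  ((k%:R : R)%:E <= ereal_inf [set ((n%:R : R)%:E) | n in [set n | p n]])%E.
Proof.
move=> np; apply: le_ereal_inf_tmp => _ [n pn <-].
by rewrite lee_fin ler_nat leqNgt; apply/negP => /np/negP.
Qed.

Lemma ereal_inf_nat (p : pred nat) k : p k -> (forall n, (n < k)%N -> ~~ p n) ->
  ereal_inf [set ((n%:R : R)%:E) | n in [set n | p n]] = k%:R%:E.
Proof.
move=> pk np; apply/eqP; rewrite eq_le ereal_inf_nat_ge// andbT.
by apply: ereal_inf_lbound; exists k.
Qed.

Context {m : nat} (B : 'I_m -> seq Sigma).
Context (B_reduced : forall i j : 'I_m, i != j -> ~~ infix (B i) (B j)).
Context (A_init : forall i : 'I_m, ~~ infix (B i) (take (size A).-1 A)).

Lemma pattern_neq0 i : (0 < size (B i))%N.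
Proof. by have := A_init i; case: (B i) => //; rewrite infix0s. Qed.

Lemma pattern_free_init w p : (p <= (size A).-1)%N -> pattern_free (text w) B p.
Proof.
move=> le_p; apply: (pattern_free_anti le_p); apply/forallP=> i.
by rewrite block_text_init// leq_pred.
Qed.

Lemma hit_init w j p : (p < size A)%N -> ~~ hit (text w) B j p.
Proof.
move=> lt_p; apply/negP => /hit_nfree/negP; apply.
by apply: pattern_free_init; lia.
Qed.

Lemma waiting_timeE w j : waiting_time X A (B j) w =
  ereal_inf [set ((k%:R : R)%:E) | k in
    [set k | infix (B j) (block (text w) 0 (size A + k))]].
Proof.
congr ereal_inf; congr (_ @` _).
by apply/seteqP; split=> k /=; rewrite block_text.
Qed.

(** Positions in the text are shifted by [size A] with respect to waiting
    times.  Uniqueness of the completed pattern makes the events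
    [tau = tau_j] disjoint where [tau] is finite. *)
Lemma hit_waiting_time w j k : hit (text w) B j (size A + k) ->
  first_waiting_time X A B w = (k%:R : R)%:E /\
  forall j', waiting_time X A (B j') w = (k%:R : R)%:E <-> j' = j.
Proof.
move=> h.
have free n : (n < k)%N -> forall i, ~~ infix (B i) (block (text w) 0 (size A + n)).
  move=> lt_nk; apply/forallP; case/andP: h => /pattern_free_anti + _; apply; lia.
have wj : waiting_time X A (B j) w = (k%:R : R)%:E.
  rewrite waiting_timeE; apply: ereal_inf_nat => [|n /free//].
  by case/andP: h => _ /suffixW.
have wge i : ((k%:R : R)%:E <= waiting_time X A (B i) w)%E.
  by rewrite waiting_timeE; apply: ereal_inf_nat_ge => n /free.
split.
  apply/eqP; rewrite eq_le; apply/andP; split.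
    by rewrite -wj; apply: bigmin_le.
  by apply: le_bigmin => //; rewrite leey.
move=> j'; split=> [wj'|-> //].
have [//|nj] := eqVneq j' j.
suff : ((k.+1%:R : R)%:E <= waiting_time X A (B j') w)%E.
  by rewrite wj' lee_fin ler_nat ltnn.
rewrite waiting_timeE; apply: ereal_inf_nat_ge => n.
rewrite ltnS leq_eqVlt => /orP[/eqP ->|/free//].
apply/negP => inf; case/negP: nj; apply/eqP.
have [fr sj] := andP h.
apply: (suffix_pattern_inj B_reduced _ sj).
have e : (size A + k).-1.+1 = (size A + k)%N.
  by rewrite prednK// (hit_gt0 pattern_neq0 h).
rewrite -e; apply: infix_blockS; rewrite ?e//.
by move/forallP: fr; apply.
Qed.

Lemma no_hit_waiting_time w :
  (forall j k, ~~ hit (text w) B j (size A + k)) ->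
  first_waiting_time X A B w = +oo%E :> \bar R.
Proof.
move=> nh; apply: bigmin_eq_id => i _; rewrite waiting_timeE.
rewrite (_ : [set k | _] = set0) ?image_set0 ?ereal_inf0//.
apply/seteqP; split=> // k /= inf.
have [|j [t [le_t h]]] := @first_hit _ (text w) _ B pattern_neq0 (size A + k).
  by apply/forallPn; exists i; rewrite negbK.
have [lt_t|le_At] := ltnP t (size A); first by have := hit_init w j lt_t; rewrite h.
by have := nh j (t - size A)%N; rewrite subnKC// h.
Qed.

End Waiting.

(** * The linear system *)

Section System.
Context {R : realType} {d : measure_display} {Omega : measurableType d}.
Context (P : probability Omega R) {Sigma : countType}.
Context (xi : Omega -> Sigma) (X : nat -> Omega -> Sigma).
Context (xi_pos : forall a : Sigma, 0 < letter_prob P xi a).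
Context (X_iid : iid_as P xi X).
Context {m : nat} (B : 'I_m -> seq Sigma).
Context (B_reduced : forall i j : 'I_m, i != j -> ~~ infix (B i) (B j)).
Context (A : seq Sigma).
Context (A_init : forall i : 'I_m, ~~ infix (B i) (take (size A).-1 A)).
Context (alpha : R) (alpha_gt0 : 0 < alpha) (alpha_lt1 : alpha < 1).

Let B_neq0 := pattern_neq0 A_init.
Let l := size A.

(** For [n = l + k] this is P(tau = tau_j = k). *)
Definition hit_pr (j : 'I_m) (n : nat) : R :=
  pr P (fun w => hit (text X A w) B j n).

(** For [n = l + k] this is P(tau > k). *)
Definition free_pr (n : nat) : R :=
  pr P (fun w => pattern_free (text X A w) B n).

(** Past the initial word, a first completion is decided by the random letters
    read so far, which is the form required by [indep_word]. *)
Lemma hit_wordE j k : exists b : pred (seq Sigma), forall w,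
  hit (text X A w) B j (l + k) = b (block (X^~ w) 0 k).
Proof.
pose b (v : seq Sigma) := [forall i, ~~ infix (B i) (take (l + k).-1 (A ++ v))]
  && suffix (B j) (A ++ v).
exists b => w; rewrite /b -!block_text /hit /pattern_free.
have -> // : take (l + k).-1 (block (text X A w) 0 (l + k)) =
             block (text X A w) 0 (l + k).-1.
have e : (l + k)%N = ((l + k).-1 + (l + k - (l + k).-1))%N by lia.
by rewrite {2}e blockD take_size_cat ?size_block.
Qed.

Lemma free_wordE k : exists b : pred (seq Sigma), forall w,
  pattern_free (text X A w) B (l + k) = b (block (X^~ w) 0 k).
Proof.
exists (fun v => [forall i, ~~ infix (B i) (A ++ v)]) => w.
by rewrite -block_text.
Qed.

Lemma discrete_text p k : discrete_rv (fun w => block (text X A w) p k).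
Proof.
case: X_iid => dX _ _; apply: (discrete_block (Y := fun n w => text X A w n)) => n.
rewrite /text; case: ltnP => lt_n; last exact: dX.
move=> E; exact: (dX 0%N [set a | E (nth a A n)]).
Qed.

Lemma measurable_free n : measurable [set w | pattern_free (text X A w) B n].
Proof.
exact: (measurable_discrete (fun v => [forall i, ~~ infix (B i) v])
                            (discrete_text 0 n)).
Qed.

Lemma measurable_hit j n : measurable [set w | hit (text X A w) B j n].
Proof.
apply: measurable_andb; first exact: measurable_free.
exact: (measurable_discrete (suffix (B j)) (discrete_text 0 n)).
Qed.

Lemma hit_pr0 j n : (n < l)%N || (n < size (B j))%N -> hit_pr j n = 0.
Proof.
case/orP=> lt_n; apply: pr_false => w; first exact: hit_init.
by apply: contraTN lt_n => /hit_size; rewrite -leqNgt.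
Qed.

(** Inside the initial word, where the letters are not random, both sides vanish
    since no pattern is completed there. *)
Lemma hit_pr_indep j n u :
  pr P (fun w => hit (text X A w) B j n && (block (text X A w) n (size u) == u)) =
  hit_pr j n * word_prob P xi u.
Proof.
have [lt_n|/subnKC <-] := ltnP n l.
  rewrite hit_pr0 ?lt_n// mul0r pr_false// => w.
  by rewrite negb_and hit_init.
have [b bE] := hit_wordE j (n - l).
rewrite /hit_pr (eq_pr _ bE) -(indep_word X_iid); apply: eq_pr => w.
by rewrite bE block_text_ge.
Qed.

Lemma free_pr_indep k u :
  pr P (fun w => pattern_free (text X A w) B (l + k) &&
                 (block (text X A w) (l + k) (size u) == u)) =
  free_pr (l + k) * word_prob P xi u.
Proof.
have [b bE] := free_wordE k.
rewrite /free_pr (eq_pr _ bE) -(indep_word X_iid); apply: eq_pr => w.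
by rewrite bE block_text_ge.
Qed.

Lemma word_prob_gt0 u : 0 < word_prob P xi u.
Proof. by apply: prodr_gt0 => a _; apply: xi_pos. Qed.

Lemma word_prob_cat u v : word_prob P xi (u ++ v) = word_prob P xi u * word_prob P xi v.
Proof. by rewrite /word_prob big_cat. Qed.

(** A term of the correlation without its power of [alpha]. *)
Definition overlap_coef (C D : seq Sigma) (r : nat) : R :=
  (drop (size C - r) C == take r D)%:R / word_prob P xi (take r D).

Lemma correlationE C D : correlation P xi C D alpha =
  \sum_(1 <= r < (minn (size C) (size D)).+1) overlap_coef C D r / alpha ^+ r.
Proof. by apply: eq_bigr => r _; rewrite invfM mulrA. Qed.

(** Probability of the event that is partitioned in [has_overlap_hit]. *)
Definition occ_pr i p : R :=
  pr P (fun w => pattern_free (text X A w) B p &&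
                 (block (text X A w) p (size (B i)) == B i)).

Lemma occ_pr_hit i p : occ_pr i p / word_prob P xi (B i) =
  \sum_j \sum_(1 <= r < (minn (size (B j)) (size (B i))).+1)
     overlap_coef (B j) (B i) r * hit_pr j (p + r).
Proof.
have termE j r : pr P (fun w => overlap_hit (text X A w) B i p (j, r)) /
    word_prob P xi (B i) = overlap_coef (B j) (B i) r * hit_pr j (p + r).
  rewrite /overlap_coef; set ov := _ == _.
  have -> : pr P (fun w => overlap_hit (text X A w) B i p (j, r)) =
      ov%:R * (hit_pr j (p + r) * word_prob P xi (drop r (B i))).
    rewrite -hit_pr_indep size_drop /overlap_hit /= -/ov.
    by case: ov; rewrite ?mul1r// mul0r pr_false.
  rewrite -{2}(cat_take_drop r (B i)) word_prob_cat.
  have /lt0r_neq0 := word_prob_gt0 (take r (B i)).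
  have /lt0r_neq0 := word_prob_gt0 (drop r (B i)).
  by move=> *; field; apply/andP.
rewrite /occ_pr; under eq_pr => w do rewrite has_overlap_hit//.
rewrite pr_has ?overlaps_uniq//.
- rewrite mulr_suml (big_allpairs_dep (op := +%R)).
  by apply: eq_bigr => j _; apply: eq_bigr => r _; exact: termE.
- move=> [j r] _; apply: (measurable_andb (b := fun=> _ == _)) => /=.
    exact: (measurable_discrete (fun=> _ == _) (discrete_text 0 0)).
  apply: measurable_andb; first exact: measurable_hit.
  exact: (measurable_discrete (pred1 _) (discrete_text _ _)).
- by move=> w x y; apply: overlap_hit_inj.
Qed.

Lemma occ_pr_ge i k :
  occ_pr i (l + k) / word_prob P xi (B i) = free_pr (l + k).
Proof. by rewrite /occ_pr free_pr_indep mulfK// lt0r_neq0// word_prob_gt0. Qed.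

(** When [p] lies inside the initial word, the first [l - p] letters of the
    occurrence of [B i] are a deterministic overlap of [A] with [B i], and only
    the remaining ones are random.  If [B i] is shorter than that, it would be
    completed before the last letter of [A]. *)
Lemma occ_pr_lt i p : (p < l)%N ->
  occ_pr i p / word_prob P xi (B i) =
  if (l - p <= size (B i))%N then overlap_coef A (B i) (l - p) else 0.
Proof.
move=> lt_p; case: leqP => [le_s|lt_s]; last first.
  rewrite /occ_pr pr_false ?mul0r// => w; apply/negP => /andP[_ /eqP occ].
  case/negP: (A_init i); rewrite -(block_text_init X w (leq_pred _)).
  have e : (l.-1 = p + (size (B i) + (l.-1 - p - size (B i))))%N by lia.
  by rewrite -/l e blockD blockD occ infix_infix.
rewrite /overlap_coef subKn; last exact: ltnW.
set ov := _ == _.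
have -> : occ_pr i p = ov%:R * word_prob P xi (drop (l - p) (B i)).
  set v := drop (l - p) (B i).
  have -> : occ_pr i p = pr P (fun w => ov && (block (X^~ w) 0 (size v) == v)).
    apply: eq_pr => w; rewrite pattern_free_init//=; last by rewrite -/l; lia.
    rewrite -{1 2}(cat_take_drop (l - p) (B i)) block_eq_cat size_takel//.
    rewrite subnKC ?(ltnW lt_p)// -[X in block _ X (size (drop _ _))]addn0 block_text_ge.
    congr (_ && _).
    have : block (text X A w) 0 l = A.
      by rewrite block_text_init// take_size.
    rewrite /ov -{1}(subnKC (ltnW lt_p)) blockD add0n => e.
    by rewrite -{2}e drop_size_cat// size_block.
  case: ov; rewrite /= ?mul0r ?mul1r; last by rewrite pr_false.
  by rewrite /pr (word_law X_iid).
rewrite -{2}(cat_take_drop (l - p) (B i)) word_prob_cat.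
have /lt0r_neq0 := word_prob_gt0 (take (l - p) (B i)).
have /lt0r_neq0 := word_prob_gt0 (drop (l - p) (B i)).
by move=> *; field; apply/andP.
Qed.

Lemma sum_init i :
  \sum_(0 <= p < l) alpha ^+ p * (occ_pr i p / word_prob P xi (B i)) =
  alpha ^+ l * correlation P xi A (B i) alpha.
Proof.
rewrite correlationE big_distrr /= -/l.
transitivity (\sum_(1 <= s < l.+1)
   if (s <= size (B i))%N then alpha ^+ l * (overlap_coef A (B i) s / alpha ^+ s) else 0).
  rewrite big_add1 /= big_nat_rev /= add0n; apply: eq_big_nat => s /andP[_ lt_s].
  rewrite occ_pr_lt; last lia.
  have -> : (l - (l - s.+1) = s.+1)%N by lia.
  case: ifP => _; last by rewrite mulr0.
  rewrite -{2}(subnK lt_s) exprD.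
  have /lt0r_neq0 : 0 < alpha ^+ s.+1 by rewrite exprn_gt0.
  by move=> *; field.
rewrite -big_mkcond /= [RHS](big_nat_widen _ _ l.+1) /=; last by rewrite ltnS geq_minl.
by rewrite big_nat_cond [RHS]big_nat_cond; apply: eq_bigl => s; lia.
Qed.

Definition hit_series j := series (fun k => alpha ^+ k * hit_pr j (l + k)).

(** Shifting the summation index by [r] loses no term: [B j] is not completed
    before position [size (B j)], hence not before [r], nor inside the initial
    word. *)
Lemma sum_hit j r N : (r <= size (B j))%N ->
  \sum_(0 <= p < l + N) alpha ^+ p * hit_pr j (p + r) =
  alpha ^+ l * (hit_series j (N + r) / alpha ^+ r).
Proof.
move=> le_r.
have ar : alpha ^+ r != 0 by rewrite lt0r_neq0// exprn_gt0.
pose F t := alpha ^+ t * hit_pr j t.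
have shift : \sum_(0 <= t < r + (l + N)) F t = \sum_(0 <= p < l + N) F (p + r)%N.
  rewrite (big_cat_nat (n := r)) ?leq_addr//= big_nat big1 ?add0r.
    by rewrite -{1}[r]add0n big_addn addKn.
  by move=> t /andP[_ lt_t]; rewrite /F hit_pr0 ?mulr0// (leq_trans lt_t le_r) orbT.
have shift' : \sum_(0 <= t < l + (N + r)) F t = \sum_(0 <= k < N + r) F (l + k)%N.
  rewrite (big_cat_nat (n := l)) ?leq_addr//= big_nat big1 ?add0r.
    by rewrite -{1}[l]add0n big_addn addKn; apply: eq_bigr => k _; rewrite addnC.
  by move=> t /andP[_ lt_t]; rewrite /F hit_pr0 ?mulr0// lt_t.
transitivity ((\sum_(0 <= p < l + N) F (p + r)%N) / alpha ^+ r).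
  rewrite mulr_suml; apply: eq_bigr => p _; rewrite /F exprD.
  by field.
rewrite -shift (_ : r + (l + N) = l + (N + r))%N; last lia.
rewrite shift' mulrA /hit_series /series /= big_distrr /=; congr (_ / _).
apply: eq_bigr => k _.
by rewrite /F exprD mulrA.
Qed.

(** The equation of index [i] of the system, for partial sums; both sides are
    evaluations of the sum of [alpha ^+ p * occ_pr i p] over [p < l + N],
    divided by [alpha ^+ l * word_prob (B i)]. *)
Lemma renewal_identity i N :
  correlation P xi A (B i) alpha + series (fun k => alpha ^+ k * free_pr (l + k)) N =
  \sum_j \sum_(1 <= r < (minn (size (B j)) (size (B i))).+1)
     overlap_coef (B j) (B i) r / alpha ^+ r * hit_series j (N + r).
Proof.
have al : alpha ^+ l != 0 by rewrite lt0r_neq0// exprn_gt0.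
apply: (mulfI al).
transitivity (\sum_(0 <= p < l + N) alpha ^+ p * (occ_pr i p / word_prob P xi (B i))).
  rewrite (big_cat_nat (n := l)) ?leq_addr//= sum_init mulrDr; congr (_ + _).
  symmetry; rewrite -{1}[l]add0n big_addn addKn /series /= big_distrr /=.
  by apply: eq_bigr => k _; rewrite addnC occ_pr_ge exprD mulrA.
under eq_bigr do rewrite occ_pr_hit big_distrr /=.
rewrite exchange_big big_distrr /=; apply: eq_bigr => j _.
under eq_bigr do rewrite big_distrr /=.
rewrite exchange_big big_distrr /=; apply: eq_big_nat => r /andP[_].
rewrite ltnS leq_min => /andP[le_rj _].
under eq_bigr do rewrite mulrCA.
by rewrite -big_distrr /= sum_hit//; ring.
Qed.

(** For [k = 0] and an empty initial word the predecessor is truncated; the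
    equation survives since no pattern is empty. *)
Lemma free_pr_pred k :
  free_pr (l + k).-1 = free_pr (l + k) + \sum_j hit_pr j (l + k).
Proof.
set n := (l + k)%N.
rewrite -pr_has ?index_enum_uniq//; first last.
- by move=> w i j h h'; have [] := hit_inj B_reduced h h'.
- by move=> j _; apply: measurable_hit.
rewrite -prU; first last.
- by move=> w free; apply/hasPn => j _; apply: contraL free; apply: hit_nfree.
- by apply: measurable_has => j _; apply: measurable_hit.
- exact: measurable_free.
apply: eq_pr => w; apply/idP/orP => [free|[free|/hasP[j _ /andP[]//]]]; last first.
  by apply: pattern_free_anti free; apply: leq_pred.
have [|nfree] := boolP (pattern_free (text X A w) B n); [by left|right].
have [j [t [le_t h]]] := first_hit B_neq0 nfree.
apply/hasP; exists j; first exact: mem_index_enum.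
rewrite (_ : n = t)//; apply/eqP; rewrite eqn_leq le_t andbT leqNgt.
apply/negP => lt_t; case/negP: (hit_nfree h).
by apply: pattern_free_anti free; lia.
Qed.

Lemma free_pr_init : free_pr l.-1 = 1.
Proof. by apply: pr_true => w; apply: pattern_free_init. Qed.

(** Abel summation, with the boundary term that vanishes in the limit. *)
Lemma free_series N :
  (1 - alpha) * series (fun k => alpha ^+ k * free_pr (l + k)) N =
  1 - series (fun k => alpha ^+ k * \sum_j hit_pr j (l + k)) N
    - alpha ^+ N * free_pr (l + N).-1.
Proof.
elim: N => [|N IH].
  by rewrite !seriesEnat/= !big_geq// addn0 free_pr_init expr0; ring.
rewrite !seriesSr mulrDr IH free_pr_pred addnS /= exprS.
ring.
Qed.

Lemma gen_fun_cvg j : hit_series j @ \oo --> gen_fun P X A B j alpha.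
Proof.
apply: expectation_levels.
- by rewrite alpha_gt0.
- by move=> k; apply: measurable_hit.
- by move=> w k k' h h'; have [_ /addnI] := hit_inj B_reduced h h'.
- move=> w k h; have [wt0 wt] := hit_waiting_time (R := R) B_reduced A_init h.
  rewrite wt0 indicE mem_set /=; last by rewrite wt0; apply/esym/wt.
  by rewrite mulr1 powR_mulrn// ltW.
- move=> w nh.
  have [[i [k h]]|nh'] := pselect (exists i k, hit (text X A w) B i (l + k)).
    have [wt0 wt] := hit_waiting_time (R := R) B_reduced A_init h.
    rewrite indicE memNset ?mulr0//= wt0 => /esym/wt ij.
    by have := nh k; rewrite ij h.
  rewrite (no_hit_waiting_time A_init) ?mul0r// => i k.
  by apply/negP => h; apply: nh'; exists i, k.
Qed.

Lemma pow_time_cvg :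
  series (fun k => alpha ^+ k * \sum_j hit_pr j (l + k)) @ \oo -->
  fine ('E_P[fun w => pow_time alpha (first_waiting_time X A B w)]).
Proof.
have -> : (fun k => alpha ^+ k * \sum_j hit_pr j (l + k)) =
  (fun k => alpha ^+ k * pr P (fun w =>
     has (fun j => hit (text X A w) B j (l + k)) (index_enum 'I_m))).
  apply/funext => k; rewrite pr_has ?index_enum_uniq//.
  - by move=> j _; apply: measurable_hit.
  - by move=> w i j h h'; have [] := hit_inj B_reduced h h'.
apply: expectation_levels.
- by rewrite alpha_gt0.
- by move=> k; apply: measurable_has => j _; apply: measurable_hit.
- move=> w k k' /hasP[j _ h] /hasP[j' _ h'].
  by have [_ /addnI] := hit_inj B_reduced h h'.
- move=> w k /hasP[j _ h]; have [-> _] := hit_waiting_time (R := R) B_reduced A_init h.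
  by rewrite /= powR_mulrn// ltW.
- move=> w nh; rewrite (no_hit_waiting_time A_init)// => j k.
  by have /hasPn := nh k; apply; rewrite mem_index_enum.
Qed.

Lemma gen_fun_sum : \sum_j gen_fun P X A B j alpha =
  fine ('E_P[fun w => pow_time alpha (first_waiting_time X A B w)]).
Proof.
apply: (norm_cvg_unique _ pow_time_cvg).
have -> : series (fun k => alpha ^+ k * \sum_j hit_pr j (l + k)) =
          fun N => \sum_j hit_series j N.
  apply/funext => N; rewrite /hit_series /series /= exchange_big /=.
  by apply: eq_bigr => k _; rewrite big_distrr.
by apply: cvg_big => [|j _]; [exact: add_continuous|]; apply: gen_fun_cvg.
Qed.

Lemma free_series_cvg :
  series (fun k => alpha ^+ k * free_pr (l + k)) @ \oo --> tail_gen_fun P X A B alpha.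
Proof.
have a1 : 1 - alpha != 0 by rewrite subr_eq0 gt_eqF.
have -> : series (fun k => alpha ^+ k * free_pr (l + k)) = fun N =>
   (1 - series (fun k => alpha ^+ k * \sum_j hit_pr j (l + k)) N
    - alpha ^+ N * free_pr (l + N).-1) / (1 - alpha).
  by apply/funext => N; rewrite -free_series mulrC mulKf.
apply: cvgMr_tmp.
rewrite -[X in _ --> X]subr0.
apply: cvgB; first by apply: cvgB; [exact: cvg_cst | exact: pow_time_cvg].
apply: (@squeeze_cvgr _ _ _ _ (fun=> 0) (fun N => alpha ^+ N)).
- near=> N; apply/andP; split; first by rewrite mulr_ge0 ?pr_ge0// exprn_ge0// ltW.
  by apply: ler_piMr; [rewrite exprn_ge0// ltW|apply: pr_le1; apply: measurable_free].
- exact: cvg_cst.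
- by apply: cvg_expr; rewrite gtr0_norm.
Unshelve. all: by end_near.
Qed.

Lemma waiting_system_gen_fun :
  waiting_system P xi A B alpha (tail_gen_fun P X A B alpha)
    (fun j => gen_fun P X A B j alpha).
Proof.
have a1 : 1 - alpha != 0 by rewrite subr_eq0 gt_eqF.
split.
  by rewrite /tail_gen_fun mulrC divfK// gen_fun_sum subrK.
move=> i; apply/eqP; rewrite addrC subr_eq; apply/eqP.
pose F N := correlation P xi A (B i) alpha +
  series (fun k => alpha ^+ k * free_pr (l + k)) N.
have c1 : F @ \oo --> correlation P xi A (B i) alpha + tail_gen_fun P X A B alpha.
  by apply: cvgD; [exact: cvg_cst | exact: free_series_cvg].
have c2 : F @ \oo --> \sum_j correlation P xi (B j) (B i) alpha * gen_fun P X A B j alpha.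
  rewrite (_ : F = fun N => \sum_j
    \sum_(1 <= r < (minn (size (B j)) (size (B i))).+1)
       overlap_coef (B j) (B i) r / alpha ^+ r * hit_series j (N + r)).
    apply: cvg_big => [|j _]; first exact: add_continuous.
    rewrite correlationE big_distrl /=.
    apply: cvg_big => [|r _]; first exact: add_continuous.
    apply: cvgMl_tmp; rewrite cvg_shiftn; exact: gen_fun_cvg.
  by apply/funext => N; apply: renewal_identity.
exact: norm_cvg_unique c2 c1.
Qed.

End System.

(** * Nonsingularity of the system *)

Section Nonsingular.
Context {R : realType} {d : measure_display} {Omega : measurableType d}.
Context (P : probability Omega R) {Sigma : countType}.
Context (xi : Omega -> Sigma) (X : nat -> Omega -> Sigma).
Context (xi_pos : forall a : Sigma, 0 < letter_prob P xi a).
Context (X_iid : iid_as P xi X).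
Context {m : nat} (B : 'I_m -> seq Sigma).
Context (B_reduced : forall i j : 'I_m, i != j -> ~~ infix (B i) (B j)).
Context (B_neq0 : forall i, (0 < size (B i))%N).
Context (alpha : R) (alpha_gt0 : 0 < alpha) (alpha_lt1 : alpha < 1).

Definition system_mx : 'M[R]_m.+1 :=
  bordered_mx (1 - alpha) (const_mx (-1)) (corr_mx P xi B alpha).

Definition system_rhs (A : seq Sigma) : 'cV[R]_m.+1 :=
  bordered_col 1 (fun i => correlation P xi A (B i) alpha).

Lemma waiting_systemE A q h :
  waiting_system P xi A B alpha q h <->
  system_mx *m bordered_col q h = system_rhs A.
Proof.
rewrite bordered_mulE /waiting_system.
suff E i : (const_mx (-1) : 'cV[R]_m) i 0 * q + \sum_j corr_mx P xi B alpha i j * h j =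
    - q + \sum_j correlation P xi (B j) (B i) alpha * h j.
  by split=> -[? e]; split=> // i; [rewrite E|rewrite -E]; exact: e.
by rewrite mxE mulN1r; congr (_ + _); apply: eq_bigr => j _; rewrite mxE.
Qed.

(** The solution is the one given by the waiting problem started from [A]; the
    matrix does not depend on [A]. *)
Lemma system_solvable A :
  (forall i : 'I_m, ~~ infix (B i) (take (size A).-1 A)) ->
  exists x, system_mx *m x = system_rhs A.
Proof.
move=> A_init; eexists; apply/waiting_systemE.
exact: (waiting_system_gen_fun xi_pos X_iid B_reduced A_init alpha_gt0 alpha_lt1).
Qed.

Lemma system_solvable_infix A i : infix A (B i) ->
  exists x, system_mx *m x = system_rhs A.
Proof.
move=> AB; apply: system_solvable => j; apply/negP => jA.
have jB : infix (B j) (B i).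
  by apply: infix_trans AB; apply: infix_trans jA _; apply: infix_take.
have ji := infix_pattern_inj B_reduced jB.
have := size_infix jA; have := size_infix AB; have := B_neq0 i.
rewrite ji size_takel ?leq_pred// => h1 h2 h3.
have := leq_trans h1 h3; have := leq_trans h2 h3.
by case: (size A) => [|n] /=; rewrite ?ltnn.
Qed.

(** Dropping the first letter of [B i] removes only the overlap of full length,
    which occurs with [B k] exactly when [B i] is a prefix of [B k]. *)
Lemma correlation_behead i k :
  correlation P xi (B i) (B k) alpha - correlation P xi (behead (B i)) (B k) alpha =
  (k == i)%:R / (word_prob P xi (B i) * alpha ^+ size (B i)).
Proof.
rewrite /correlation size_behead; set n := size (B i).
have n_gt0 : (0 < n)%N by apply: B_neq0.
have E r : (r <= n.-1)%N -> drop (n.-1 - r) (behead (B i)) = drop (n - r) (B i).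
  by move=> le_r; rewrite -drop1 drop_drop; congr drop; lia.
have -> : \sum_(1 <= r < (minn n.-1 (size (B k))).+1)
     (drop (n.-1 - r) (behead (B i)) == take r (B k))%:R /
       (word_prob P xi (take r (B k)) * alpha ^+ r) =
   \sum_(1 <= r < (minn n.-1 (size (B k))).+1)
     (drop (n - r) (B i) == take r (B k))%:R /
       (word_prob P xi (take r (B k)) * alpha ^+ r).
  by apply: eq_big_nat => r /andP[_ lt_r]; rewrite E//; lia.
have [lt_k|le_k] := ltnP (size (B k)) n.
  have -> : minn n.-1 (size (B k)) = size (B k) by lia.
  rewrite subrr (_ : (k == i) = false) ?mul0r//.
  by apply/eqP => ki; move: lt_k; rewrite ki ltnn.
have -> : minn n.-1 (size (B k)) = n.-1 by lia.
rewrite (prednK n_gt0) big_nat_recr//= addrAC subrr add0r subnn drop0.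
have [->|ki] := eqVneq k i; first by rewrite take_size eqxx.
rewrite (_ : (_ == take _ _) = false) ?mul0r//.
apply/eqP => e; have ik : i != k by rewrite eq_sym.
case/negP: (B_reduced ik).
by rewrite e infix_take.
Qed.

(** Every basis vector is in the image: the first one is the right-hand side
    for the empty initial word, the others are scaled differences of the
    right-hand sides for [B i] and [behead (B i)]. *)
Lemma system_det_neq0 : \det system_mx != 0.
Proof.
apply: solvable_det_neq0 => k; case: (unliftP ord0 k) => [i|] ->; last first.
  have [|x xE] := @system_solvable [::].
    by move=> i; have := B_neq0 i; rewrite infixs0; case: (B i).
  exists x; rewrite xE; apply/matrixP=> a b; rewrite !mxE ord1 eqxx andbT.
  case: (unliftP ord0 a) => [a'|] ->; last by rewrite eqxx.
  by rewrite /correlation min0n big_geq//.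
have [x xE] := system_solvable_infix (infix_refl (B i)).
have beheadP : infix (behead (B i)) (B i) by rewrite -drop1 infix_drop.
have [y yE] := system_solvable_infix beheadP.
pose c := word_prob P xi (B i) * alpha ^+ size (B i).
have c0 : c != 0 by rewrite lt0r_neq0// mulr_gt0 ?exprn_gt0// word_prob_gt0.
exists (c *: (x - y)); rewrite -scalemxAr mulmxBr xE yE.
apply/matrixP=> a b; rewrite !mxE ord1 eqxx andbT.
case: (unliftP ord0 a) => [a'|] ->.
  by rewrite correlation_behead -/c (inj_eq (@lift_inj _ _)) mulrC divfK.
by rewrite subrr mulr0 (negbTE (neq_lift _ _)).
Qed.

End Nonsingular.

(* [infix u v] says that u is a contiguous block of v.  The hypothesis on A
   involves a_1 ... a_(l-1) = take (size A).-1 A; as [infix [::] v] always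
   holds, it also makes every B i nonempty. *)
Theorem proposition4p1
  (R : realType) (d : measure_display) (Omega : measurableType d)
  (P : probability Omega R) (Sigma : countType)
  (xi : Omega -> Sigma) (X : nat -> Omega -> Sigma)
  (xi_rv : discrete_rv xi)
  (xi_pos : forall a : Sigma, 0 < letter_prob P xi a)
  (X_iid : iid_as P xi X)
  (m : nat) (B : 'I_m -> seq Sigma)
  (B_reduced : forall i j : 'I_m, i != j -> ~~ infix (B i) (B j))
  (A : seq Sigma)
  (A_init : forall i : 'I_m, ~~ infix (B i) (take (size A).-1 A))
  (alpha : R) (alpha_gt0 : 0 < alpha) (alpha_lt1 : alpha < 1) :
  let Q := tail_gen_fun P X A B alpha in
  let g := fun j : 'I_m => gen_fun P X A B j alpha in
  let D := (1 - alpha) * \det (corr_mx P xi B alpha)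
           + \sum_(j < m) \det (corr_mx_up P xi B alpha j) in
  [/\ waiting_system P xi A B alpha Q g,
      (forall (q : R) (h : 'I_m -> R),
         waiting_system P xi A B alpha q h -> q = Q /\ forall k, h k = g k),
      D != 0,
      Q = (\det (corr_mx P xi B alpha)
           - \sum_(k < m) \det (corr_mx_low P xi A B alpha k)) / D
    & forall k : 'I_m,
        g k = ((1 - alpha) * \det (corr_mx_low P xi A B alpha k)
               + \sum_(j < m) \det (corr_mx_low_up P xi A B alpha k j)) / D].
Proof.
move=> Q g D.
have sys : waiting_system P xi A B alpha Q g.
  exact: (waiting_system_gen_fun xi_pos X_iid B_reduced A_init alpha_gt0 alpha_lt1).
have detD : \det (system_mx P xi B alpha) = D by rewrite det_bordered_opp.
have D0 : D != 0.
  rewrite -detD.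
  exact: (system_det_neq0 xi_pos X_iid B_reduced (pattern_neq0 A_init)
            alpha_gt0 alpha_lt1).
have Q_formula q h : waiting_system P xi A B alpha q h ->
    q = (\det (corr_mx P xi B alpha)
           - \sum_(k < m) \det (corr_mx_low P xi A B alpha k)) / D.
  move=> /waiting_systemE /(cramer ord0).
  rewrite detD mxE unlift_none replace_bordered0 det_bordered mul1r => e.
  by rewrite -[LHS](mulKf D0) mulrC e.
have g_formula q h : waiting_system P xi A B alpha q h -> forall k,
    h k = ((1 - alpha) * \det (corr_mx_low P xi A B alpha k)
               + \sum_(j < m) \det (corr_mx_low_up P xi A B alpha k j)) / D.
  move=> /waiting_systemE + k => /(cramer (lift ord0 k)).
  rewrite detD mxE liftK replace_borderedS det_bordered_opp => e.
  by rewrite -[LHS](mulKf D0) mulrC e.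
split=> //.
- move=> q h sysh; split; first by rewrite (Q_formula _ _ sysh) -(Q_formula _ _ sys).
  by move=> k; rewrite (g_formula _ _ sysh) -(g_formula _ _ sys).
- exact: Q_formula sys.
- exact: g_formula sys.
Qed.
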